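(* Let $L_{\mathcal P}=\{u\in\{0,1\}^+\mid u=u^R\}$ and $L_{\mathrm{cl}}=(1\cup\lambda)(01)^*(0\cup\lambda)$, where $\lambda$ is the empty word. Then $\mathcal G_{L_{\mathcal P}\cap L_{\mathrm{cl}}}$ is exactly the class of bipartite graphs.
   Context: $u^R$ is the reversal of $u$. $L_{\mathrm{cl}}$ is the language of all alternating binary words (no factor $00$ or $11$). A graph $G=(V,E)$ is bipartite if $V$ is the disjoint union of two (possibly empty) sets each containing no edge. Graphs are finite, undirected and simple: $G=(V,E)$ with $V$ a finite non-empty set and $E\subseteq\binom{V}{2}$. A language $L\subseteq\{0,1\}^*$ is $0$-$1$-symmetric if it is invariant under the morphism exchanging $0$ and $1$ (the language here is). For distinct letters $u,v$ of an alphabet $V$, $h_{u,v}:V^*\to\{0,1\}^*$ is the monoid morphism with $u\mapsto 0$, $v\mapsto 1$, and $x\mapsto\lambda$ for all other letters $x$. For a $0$-$1$-symmetric $L$ and a word $w\in V^*$ in which every letter of $V$ occurs, $G(L,w)$ is the graph with vertex set $V$ in which distinct $u,v$ are adjacent if and only if $h_{u,v}(w)\in L$. $\mathcal G_L$ is the class of all graphs $G=(V,E)$ with $G=G(L,w)$ for some $w\in V^*$ in which every letter of $V$ occurs. *)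

(* Defs.v *)
From mathcomp Require Import all_boot.

Set Implicit Arguments.
Unset Strict Implicit.
Unset Printing Implicit Defensive.

(* The vertex set is the whole carrier [vertex]; since edges form a {set _},
   two graphs on the same vertex set are equal when they have the same edges. *)
Record graph := Graph {
  vertex : finType;
  edges : {set {set vertex}};
  vertex_gt0 : 0 < #|vertex|;
  edges_card2 : forall e, e \in edges -> #|e| = 2
}.

Definition adjacent (G : graph) (u v : vertex G) : bool :=
  [set u; v] \in edges G.

Definition bipartite (G : graph) : Prop :=
  exists A B : {set vertex G},
    [/\ A :|: B = [set: vertex G],
        [disjoint A & B],
        forall e, e \in edges G -> ~~ (e \subset A)
      & forall e, e \in edges G -> ~~ (e \subset B)].

(* Binary words: the letter 0 is [false] and the letter 1 is [true]. *)
Definition language := seq bool -> Prop.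

Definition lang_word (s : seq bool) : language := fun u => u = s.
Definition lang_cup (L M : language) : language := fun u => L u \/ M u.
Definition lang_cap (L M : language) : language := fun u => L u /\ M u.
Definition lang_cat (L M : language) : language :=
  fun u => exists s t, [/\ u = s ++ t, L s & M t].
Definition lang_star (L : language) : language :=
  fun u => exists ss : seq (seq bool),
    u = flatten ss /\ (forall s, s \in ss -> L s).

Definition sym01 (L : language) : Prop := forall u, L (map negb u) <-> L u.

Section Representation.
Variable V : finType.

Definition hmor (u v : V) (w : seq V) : seq bool :=
  flatten [seq if x == u then [:: false]
               else if x == v then [:: true] else [::] | x <- w].

End Representation.

(* G = G(L, w).  When L is 0-1-symmetric, the condition does not depend on the
   order of u and v, and it determines the edge set, hence G, from L and w. *)
Definition represents (L : language) (G : graph) (w : seq (vertex G)) : Prop :=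
  forall u v : vertex G, u != v -> (adjacent u v <-> L (hmor u v w)).

Definition graph_class (L : language) (G : graph) : Prop :=
  exists w : seq (vertex G), (forall x, x \in w) /\ represents L w.

Definition L_P : language := fun u => u <> [::] /\ u = rev u.

Definition L_cl : language :=
  lang_cat (lang_cup (lang_word [:: true]) (lang_word [::]))
    (lang_cat (lang_star (lang_word [:: false; true]))
              (lang_cup (lang_word [:: false]) (lang_word [::]))).

Definition alternating : pred (seq bool) := sorted (fun a b => a != b).

Lemma L_cl_alternating u : L_cl u <-> alternating u.
Proof.
split.
  case=> p [q [-> Hp [s [t [-> [ss [-> Hss]] Ht]]]]].
  have alt_t : path (fun a b => a != b) true t by case: Ht => ->.
  have alt_q : path (fun a b => a != b) true (flatten ss ++ t).
    elim: ss Hss => [|s1 ss IH] H //=.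
    rewrite (H s1 (mem_head _ _)) /=; apply: IH => s2 Hs2.
    by apply: H; rewrite inE Hs2 orbT.
  case: Hp => -> //=.
  by rewrite /alternating; case: (flatten ss ++ t) alt_q => //= a r /andP[].
have alt_true n : forall v, size v <= n ->
    path (fun a b => a != b) true v ->
    lang_cat (lang_star (lang_word [:: false; true]))
             (lang_cup (lang_word [:: false]) (lang_word [::])) v.
  elim: n => [|n IH] [|[] v] //= sz.
  - by exists [::], [::]; split=> //; [exists [::] | right].
  - by exists [::], [::]; split=> //; [exists [::] | right].
  case: v sz => [|[] v] //= sz.
    by exists [::], [:: false]; split=> //; [exists [::] | left].
  move=> /(IH v (ltnW sz))[s [t [-> [ss [-> Hss]] Ht]]].
  exists [:: false, true & flatten ss], t; split=> //.
  exists ([:: false; true] :: ss); split=> // s2.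
  by rewrite inE => /orP[/eqP-> | /Hss].
case: u => [|[] u] alt_u.
- by exists [::], [::]; split; [| right | apply: (alt_true 0)].
- by exists [:: true], u; split; [| left | apply: (alt_true (size u))].
by exists [::], (false :: u); split; [| right | apply: (alt_true (size u).+1)].
Qed.

Lemma sym01_L_P_L_cl : sym01 (lang_cap L_P L_cl).
Proof.
move=> u.
have alt_negb : alternating (map negb u) = alternating u.
  by rewrite /alternating sorted_map; apply: eq_sorted => -[] [].
have negb_inj : injective negb by case=> [] [].
split=> [[[nz pal]] | [[nz pal]]] /L_cl_alternating alt; split.
- split; first by case: u nz {pal alt alt_negb}.
  by apply: (inj_map negb_inj); rewrite map_rev.
- by apply/L_cl_alternating; rewrite -alt_negb.
- split; first by case: u nz {pal alt alt_negb}.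
  by rewrite -map_rev -pal.
by apply/L_cl_alternating; rewrite alt_negb.
Qed.

(* Main.v *)
Require Import Defs.
From mathcomp Require Import all_boot.

(** An alternating nonempty binary word is a palindrome exactly when its length
    is odd.  So if [w] represents [G], then the numbers of occurrences in [w] of
    adjacent letters have different parities, and the parity of the number of
    occurrences is a 2-colouring.  Conversely, if [A] and [~: A] contain no
    edge, take the product over [x] in [A] of the blocks
    [N(x) x (~: A \ N(x)) (A \ x)], followed by [~: A].  Letters on the same
    side occur equally often, hence are not adjacent.  For [a] in [A] and [b] in
    [~: A], every block projects to [ba], except that the block of [a] projects
    to [ab] when [a] and [b] are not adjacent; and there is a final [b]. *)

Lemma alternating_nth b s i : path (fun a b => a != b) b s -> i <= size s ->
  nth b (b :: s) i = b (+) odd i.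
Proof.
elim: s b i => [|c s IHs] b [|i] //=; rewrite ?addbF // => /andP[bc cs] lt_i.
(* The induction hypothesis reads the tail with its own first letter [c] as default; the index is in
   bounds, so the default may be changed. *)
rewrite (set_nth_default c) //= IHs //.
by case: b c (odd i) bc {cs IHs} => [] [] [].
Qed.

(** In an alternating word two letters agree iff their positions have the same parity. A palindrome
    has equal first and last letters, which forces odd length; in odd length, mirror positions have
    equal parity. *)
Lemma alternating_palindrome s :
  lang_cap L_P L_cl s <-> alternating s && odd (size s).
Proof.
split=> [[[s_neq0 pal_s] /L_cl_alternating alt_s] | /andP[alt_s odd_s]].
  rewrite alt_s; case: s s_neq0 pal_s alt_s => //= b s _ pal_s alt_s.
  have := alternating_nth _ _ _ alt_s (leqnn (size s)).
  rewrite {1}pal_s nth_rev //= subnn /=.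
  by case: b (odd (size s)) {pal_s alt_s} => [] [].
split; last exact/L_cl_alternating.
split; first by case: s odd_s {alt_s}.
case: s alt_s odd_s => // b s alt_s /= /negbTE even_s.
apply: (@eq_from_nth _ b) => [|i lt_i]; first by rewrite size_rev.
rewrite nth_rev // subSS !alternating_nth ?leq_subr //.
by rewrite oddB // even_s.
Qed.

(** A palindrome ending in 0 also begins with 0, so it still alternates after a preceding 1. *)
Lemma palindrome_path_last s : lang_cap L_P L_cl (rcons s false) ->
  path (fun a b => a != b) true (rcons s false).
Proof.
case=> [[_ pal_s] /L_cl_alternating]; move: pal_s.
by rewrite rev_rcons; case: s => [|[] s].
Qed.

Section Projection.
Variable V : finType.
Implicit Types (u v x : V) (s t : seq V).

Lemma hmor_cat u v s t : hmor u v (s ++ t) = hmor u v s ++ hmor u v t.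
Proof. by rewrite /hmor map_cat flatten_cat. Qed.

Lemma hmor_cons u v x s : hmor u v (x :: s) =
  (if x == u then [:: false] else if x == v then [:: true] else [::])
    ++ hmor u v s.
Proof. by []. Qed.

Lemma hmor_swap u v s : u != v -> hmor v u s = map negb (hmor u v s).
Proof.
move=> uv; elim: s => // x s IHs; rewrite !hmor_cons IHs map_cat.
by case: (eqVneq x u) => [->|_]; [rewrite (negbTE uv) | case: eqP].
Qed.

Lemma size_hmor u v s : u != v ->
  size (hmor u v s) = count_mem u s + count_mem v s.
Proof.
move=> uv; elim: s => // x s IHs; rewrite hmor_cons size_cat IHs /=.
case: (eqVneq x u) => [->|_]; first by rewrite (negbTE uv).
by case: eqP => _; rewrite ?addnS.
Qed.

Lemma hmor_notin_r u v s : v \notin s ->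
  hmor u v s = nseq (count_mem u s) false.
Proof.
elim: s => // x s IHs; rewrite inE eq_sym negb_or hmor_cons.
by case/andP=> /negbTE xv /IHs->; rewrite xv /=; case: eqP.
Qed.

Lemma hmor_notin_l u v s : u \notin s ->
  hmor u v s = nseq (count_mem v s) true.
Proof.
elim: s => // x s IHs; rewrite inE eq_sym negb_or hmor_cons.
by case/andP=> /negbTE xu /IHs->; rewrite xu /=; case: eqP.
Qed.

Lemma count_mem_enum u (S : {set V}) : count_mem u (enum S) = (u \in S).
Proof. by rewrite count_uniq_mem ?enum_uniq // mem_enum. Qed.

End Projection.

Lemma adjacentC (G : graph) (u v : vertex G) : adjacent u v = adjacent v u.
Proof. by rewrite /adjacent setUC. Qed.

Section BipartiteWord.
Variables (G : graph) (A : {set vertex G}).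
Implicit Types (a b x : vertex G) (s : seq (vertex G)).

Definition opposite_neighbours x : {set vertex G} :=
  [set y in ~: A | adjacent x y].

Definition bipartite_block x : seq (vertex G) :=
  enum (opposite_neighbours x)
    ++ x :: enum (~: A :\: opposite_neighbours x) ++ enum (A :\ x).

Definition bipartite_prefix s : seq (vertex G) :=
  flatten [seq bipartite_block x | x <- s].

Definition bipartite_word : seq (vertex G) :=
  bipartite_prefix (enum A) ++ enum (~: A).

(** The four pieces of a block partition the vertex set. *)
Lemma count_bipartite_block u x : x \in A ->
  count_mem u (bipartite_block x) = 1.
Proof.
move=> xA; rewrite /bipartite_block count_cat /= count_cat !count_mem_enum.
rewrite !inE; case: (eqVneq x u) => [<-|_]; first by rewrite xA.
by case: (u \in A); case: adjacent.
Qed.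

Lemma count_bipartite_prefix u s : {subset s <= A} ->
  count_mem u (bipartite_prefix s) = size s.
Proof.
elim: s => // x s IHs sA; rewrite /bipartite_prefix /= count_cat.
rewrite count_bipartite_block ?sA ?mem_head // IHs // => y ys.
by rewrite sA // inE ys orbT.
Qed.

Lemma count_bipartite_word u :
  count_mem u bipartite_word = #|A| + (u \notin A).
Proof.
rewrite count_cat count_bipartite_prefix => [|x]; last by rewrite mem_enum.
by rewrite count_mem_enum inE -cardE.
Qed.

Lemma hmor_bipartite_block a b x : a \in A -> b \notin A -> x \in A ->
  hmor b a (bipartite_block x) =
    if (x == a) && ~~ adjacent a b then [:: true; false]
    else [:: false; true].
Proof.
move=> aA bA xA; have xb : x != b by apply: contraNneq bA => <-.
rewrite /bipartite_block hmor_cat hmor_cons hmor_cat (negbTE xb).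
(* Here [b] is coded by 0 and [a] by 1. The piece inside [A] avoids [b] and the two pieces inside
   [~: A] avoid [a]. If [x] is not [a], then [a] lies in the last piece, after [b]; if [x] is [a],
   then [b] precedes it iff they are adjacent. *)
rewrite (hmor_notin_l _ b a (enum (A :\ x))); last first.
  by rewrite mem_enum inE (negbTE bA) andbF.
rewrite !(hmor_notin_r _ b a (enum _)) ?mem_enum ?inE ?aA ?andbF //.
rewrite !count_mem_enum !inE aA bA (eq_sym a x).
by case: (eqVneq x a) => [->|_]; case: adjacent.
Qed.

Lemma hmor_bipartite_last a b : a \in A -> b \notin A ->
  hmor b a (enum (~: A)) = [:: false].
Proof.
move=> aA bA; rewrite hmor_notin_r ?mem_enum ?inE ?aA //.
by rewrite count_mem_enum inE bA.
Qed.

(** The virtual preceding letter 1 is an invariant: a block 01 continues the alternation and ends in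
    1 again, while a block 10 breaks it at once. The appended 0 stands for the final
    [enum (~: A)]. *)
Lemma path_bipartite_prefix a b s : a \in A -> b \notin A -> {subset s <= A} ->
  path (fun c d => c != d) true (rcons (hmor b a (bipartite_prefix s)) false)
    = (a \in s) ==> adjacent a b.
Proof.
move=> aA bA; elim: s => // x s IHs sA.
have xA : x \in A by rewrite sA ?mem_head.
have {}IHs := IHs (fun y ys => sA y (mem_behead (ys : y \in behead (x :: s)))).
rewrite /bipartite_prefix /= hmor_cat hmor_bipartite_block // rcons_cat inE.
rewrite (eq_sym a x); case: (eqVneq x a) => [_|_] /=; last exact: IHs.
by case adj: (adjacent a b); rewrite //= IHs adj implybT.
Qed.

Lemma bipartite_word_opposite a b : a \in A -> b \notin A ->
  adjacent a b <-> lang_cap L_P L_cl (hmor b a bipartite_word).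
Proof.
move=> aA bA; have ba : b != a by apply: contraNneq bA => ->.
have sub_A : {subset enum A <= A} by move=> x; rewrite mem_enum.
have path_w := path_bipartite_prefix _ _ _ aA bA sub_A.
rewrite mem_enum aA implyTb -cats1 -(hmor_bipartite_last a b) // in path_w.
rewrite -hmor_cat -/bipartite_word in path_w.
split=> [|pal_w].
  rewrite -path_w => alt_w; apply/alternating_palindrome; apply/andP; split.
    exact: path_sorted alt_w.
  (* The length is twice [#|A|] plus one, hence odd. *)
  rewrite size_hmor // !count_bipartite_word aA bA.
  by rewrite addn0 oddD addn1 /= addNb addbb.
rewrite -path_w; move: pal_w; rewrite hmor_cat hmor_bipartite_last // cats1.
exact: palindrome_path_last.
Qed.

Lemma mem_bipartite_word u : u \in bipartite_word.
Proof.
rewrite -has_pred1 has_count count_bipartite_word.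
case: (boolP (u \in A)) => [uA|_]; last by rewrite addn1.
by rewrite addn0; apply/card_gt0P; exists u.
Qed.

End BipartiteWord.

Theorem theorem11 (G : graph) :
  graph_class (lang_cap L_P L_cl) G <-> bipartite G.
Proof.
split=> [[w [_ rep_w]] | [A [B [AB disjAB indA indB]]]].
  have odd_edge e : e \in edges G -> exists x y,
      [/\ x \in e, y \in e & odd (count_mem x w) != odd (count_mem y w)].
    move=> eG; have /eqP/cards2P[x [y [xy def_e]]] := edges_card2 eG.
    exists x, y; rewrite def_e !inE !eqxx orbT; split=> //.
    have /(rep_w _ _ xy) : adjacent x y by rewrite /adjacent -def_e.
    case/alternating_palindrome/andP=> _; rewrite size_hmor // oddD.
    by case: odd; case: odd.
  exists [set x | odd (count_mem x w)], (~: [set x | odd (count_mem x w)]).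
  split; first exact: setUCr.
  - by rewrite -setI_eq0 setICr.
  - move=> e /odd_edge[x [y [xe ye]]]; apply: contra => /subsetP sub_e.
    by move: (sub_e x xe) (sub_e y ye); rewrite !inE => -> ->.
  move=> e /odd_edge[x [y [xe ye]]]; apply: contra => /subsetP sub_e.
  by move: (sub_e x xe) (sub_e y ye); rewrite !inE => /negbTE-> /negbTE->.
exists (bipartite_word G A); split=> [|u v uv]; first exact: mem_bipartite_word.
have not_pal : (u \in A) = (v \in A) ->
    ~ lang_cap L_P L_cl (hmor u v (bipartite_word G A)).
  move=> uvA /alternating_palindrome/andP[_].
  by rewrite size_hmor // !count_bipartite_word uvA oddD addbb.
have subU (C : {set vertex G}) : u \in C -> v \in C -> [set u; v] \subset C.
  by move=> uC vC; apply/subsetP => x /set2P[] ->.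
(* The word is built from [~: A], whereas the absence of edges is known for [B]. *)
have inB x : x \notin A -> x \in B.
  by move=> xA; have := in_setT x; rewrite -AB inE (negbTE xA).
case: (boolP (u \in A)) (boolP (v \in A)) not_pal => [uA|uA] [vA|vA] not_pal.
- by split=> [/indA/negP[]|/not_pal[]]; rewrite ?subU.
(* That lemma codes the vertex outside [A] by 0; here this vertex is [v], so 0 and 1 are exchanged
   by the symmetry of the language. *)
- apply: iff_trans (bipartite_word_opposite _ _ _ _ uA vA) _.
  by rewrite hmor_swap //; apply: sym01_L_P_L_cl.
- by rewrite adjacentC; apply: bipartite_word_opposite.
by split=> [/indB/negP[]|/not_pal[]]; rewrite ?subU ?inB.
Qed.
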